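(* Let $(X,d)$ be a metric space. If $X$ has $k$-prisms for some $k\ge 1$, then $X$ fails to have property A.
   Context: Let $k$ be a positive integer. A metric space $(X,d)$ has $k$-prisms if for any finite set $F\subset X$ there exists a function $T\colon F\to X$ such that (1) $T(F)\cap F=\emptyset$; (2) $d(T(x),T(y))=d(x,y)$ for all $x,y\in F$; and (3) $d(x,T(y))=k+d(x,y)$ for all $x,y\in F$. A (discrete) metric space $(X,d)$ has property A if for all $R>0$ and all $\epsilon>0$ there exists a family $\{A_x\}_{x\in X}$ of finite, non-empty subsets of $X\times\mathbb{N}$ such that (1) for all $x,y\in X$ with $d(x,y)\le R$, we have $\frac{\#(A_x\Delta A_y)}{\#(A_x\cap A_y)}\le\epsilon$, and (2) there exists a $B>0$ such that for every $x\in X$, if $(y,n)\in A_x$, then $d(x,y)\le B$. Here $\#A$ is the cardinality of $A$ and $A_x\Delta A_y$ denotes the symmetric difference. *)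

(* Defs.v *)
From HB Require Import structures.
From mathcomp Require Import all_boot all_order all_algebra finmap.
From mathcomp Require Import all_classical all_reals all_analysis.

Set Implicit Arguments.
Unset Strict Implicit.
Unset Printing Implicit Defensive.

Import Order.TTheory GRing.Theory Num.Theory.

Local Open Scope classical_set_scope.
Local Open Scope fset_scope.
Local Open Scope ring_scope.

Definition has_prisms (R : realType) (X : metricType R) (k : nat) : Prop :=
  forall F : {fset X}, exists T : F -> X,
    [/\ (range T `&` [set` F] = set0)%classic,
        forall x y : F, mdist (T x) (T y) = mdist (val x) (val y) &
        forall x y : F, mdist (val x) (T y) = k%:R + mdist (val x) (val y)].

Definition fset_symdiff (K : choiceType) (A B : {fset K}) : {fset K} :=
  (A `\` B) `|` (B `\` A).

(* The quotient is meaningful only when [A x] and [A y] meet; since division by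
   zero returns zero in MathComp, this has to be required explicitly. *)
Definition property_A (R : realType) (X : metricType R) : Prop :=
  forall r eps : R, 0 < r -> 0 < eps ->
  exists A : X -> {fset X * nat},
    [/\ forall x, A x != fset0,
        forall x y, mdist x y <= r ->
          A x `&` A y != fset0 /\
          #|` fset_symdiff (A x) (A y)|%:R / #|` A x `&` A y|%:R <= eps &
        exists B : R, 0 < B /\
          forall x y n, (y, n) \in A x -> mdist x y <= B].

(* Main.v *)
Require Import Defs.
From mathcomp Require Import all_boot all_order all_algebra finmap.
From mathcomp Require Import all_classical all_reals all_analysis.
From mathcomp Require Import zify lra.

(** A space with prisms contains isometric copies of all Hamming cubes
    [{0,1}^n], scaled by [k]: from a copy of the [n]-cube, the prism over it is
    a copy of the [(n+1)]-cube ([prisms_cube]).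

    Hamming cubes cannot have property A uniformly in [n].  Suppose that the
    sets [A v] witness property A with [r = k] and [eps = 1].  Each point [a] of
    [A v] has a vertex [p a] of the cube nearby, and [v] and [p a] differ in at
    most [S] coordinates, where [S] depends only on the bound in property A.
    Let [P v i] be the proportion of points [a] of [A v] with [p a i != v i];
    thus [P v i] summed over [i] is at most [S].  Let now [w] be the neighbour
    of [v] in direction [i].  As [v i != w i], each point of [A v] that
    also lies in [A w] is counted in [P v i] or in [P w i], and these points
    make up at least half of the union of both sets, so that [P v i + P w i >= 1/2]
    ([half_le_proportions]).  Averaging over all edges of the cube, the mean of
    [P v i] is at least [1/4], whence [n <= 4 S] ([cube_dim_le]), which fails
    for large [n].

    The quantity [P v i] is the probability that a random point of [A v] is
    displaced in direction [i]; working with proportions rather than numbers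
    of points is what makes it possible to add over the whole cube, since the
    cardinality of [A v] may vary exponentially with [v]. *)

Set Implicit Arguments.
Unset Strict Implicit.
Unset Printing Implicit Defensive.

Import Order.TTheory GRing.Theory Num.Theory.

Local Open Scope fset_scope.
Local Open Scope ring_scope.

Notation cube n := {ffun 'I_n -> bool}.

Definition hamming n (u v : cube n) : nat := (\sum_(i < n) (u i != v i))%N.

Definition flip n (i : 'I_n) (v : cube n) : cube n :=
  [ffun j => v j (+) (j == i)].

Definition cube_tail n (v : cube n.+1) : cube n := [ffun i => v (lift ord0 i)].

Lemma flipK n (i : 'I_n) : involutive (flip i).
Proof. by move=> v; apply/ffunP => j; rewrite !ffunE addbK. Qed.

Lemma hamming_flip n (i : 'I_n) (v : cube n) : hamming v (flip i v) = 1%N.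
Proof.
rewrite /hamming (bigD1 i) //= big1 => [|j jNi]; rewrite ffunE.
  by rewrite eqxx; case: (v i).
by rewrite (negPf jNi) addbF eqxx.
Qed.

Lemma hamming_recl n (u v : cube n.+1) :
  hamming u v
  = ((u ord0 != v ord0) + hamming (cube_tail u) (cube_tail v))%N.
Proof.
rewrite /hamming big_ord_recl; congr addn.
by apply: eq_bigr => i _; rewrite !ffunE.
Qed.

(** The prism over a copy of the [n]-cube is a copy of the [(n+1)]-cube, the
    first coordinate telling the base from the lid. *)
Lemma prisms_cube (R : realType) (X : metricType R) (k n : nat) (x0 : X) :
  has_prisms X k ->
  exists phi : cube n -> X, forall u v,
    mdist (phi u) (phi v) = k%:R * (hamming u v)%:R.
Proof.
move=> prismX; elim: n => [|n [phi phiE]].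
  exists (fun=> x0) => u v.
  by rewrite mdistxx /hamming big_ord0 mulr0.
have [T [_ lidE sideE]] := prismX [fset phi u | u : cube n].
have phiF u : phi u \in [fset phi u | u : cube n] by apply: in_imfset.
pose lid u := T [` phiF u].
have lid_lid u v : mdist (lid u) (lid v) = k%:R * (hamming u v)%:R.
  by rewrite lidE phiE.
have base_lid u v : mdist (phi u) (lid v) = k%:R * (1 + hamming u v)%:R.
  by rewrite (sideE [` phiF u] [` phiF v]) phiE natrD mulrDr mulr1.
exists (fun v : cube n.+1 =>
  if v ord0 then lid (cube_tail v) else phi (cube_tail v)).
move=> u v; rewrite hamming_recl.
case: (u ord0) (v ord0) => [] [] /=; rewrite ?lid_lid ?base_lid ?phiE //.
rewrite metric_sym base_lid /hamming; congr (_ * (1 + _)%:R).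
by apply: eq_bigr => i _; rewrite eq_sym.
Qed.

Definition proportion (K : choiceType) (A : {fset K}) (P : pred K) : rat :=
  #|` [fset a in A | P a]|%:R / #|` A|%:R.

(** The intersection of [A] and [B] is covered by its points in [P] and its
    points in [Q], and is at least half as large as each of [A] and [B]. *)
Lemma half_le_proportions (K : choiceType) (A B : {fset K}) (P Q : pred K) :
  A `&` B != fset0 -> (#|` A `|` B| <= 2 * #|` A `&` B|)%N ->
  (forall a, P a || Q a) ->
  2^-1 <= proportion A P + proportion B Q.
Proof.
rewrite -cardfs_gt0 => I_gt0 leUI PQ.
have leAU : (#|` A| <= #|` A `|` B|)%N by rewrite fsubset_leq_card ?fsubsetUl.
have leBU : (#|` B| <= #|` A `|` B|)%N by rewrite fsubset_leq_card ?fsubsetUr.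
have leIA : (#|` A `&` B| <= #|` A|)%N by rewrite fsubset_leq_card ?fsubsetIl.
have leIB : (#|` A `&` B| <= #|` B|)%N by rewrite fsubset_leq_card ?fsubsetIr.
have leIPQ : (#|` A `&` B| <= #|` [fset a in A | P a]|
                              + #|` [fset a in B | Q a]|)%N.
  rewrite -cardfsUI (leq_trans _ (leq_addr _ _)) ?fsubset_leq_card //.
  apply/fsubsetP => a /fsetIP[aA aB].
  by rewrite !inE /= aA aB PQ.
set m := (2 * #|` A `&` B|)%N.
have m_gt0 : (0 : rat) < m%:R by rewrite ltr0n /m; lia.
have lbound (C D : {fset K}) : (0 < #|` C| <= m)%N ->
    #|` D|%:R / m%:R <= #|` D|%:R / #|` C|%:R :> rat.
  move=> /andP[C_gt0 leCm].
  rewrite ler_wpM2l ?ler0n // lef_pV2 ?posrE ?ltr0n ?ler_nat //.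
  exact: leq_trans leCm.
apply: le_trans (lerD (lbound _ _ _) (lbound _ _ _)); [|lia|lia].
rewrite -mulrDl ler_pdivlMr // /m natrM mulKf // -natrD ler_nat.
exact: leIPQ.
Qed.

Lemma sum_proportion_le n (K : choiceType) (A : {fset K}) (p : K -> cube n)
    (v : cube n) (S : nat) :
  A != fset0 -> (forall a, a \in A -> (hamming (p a) v <= S)%N) ->
  \sum_(i < n) proportion A (fun a => p a i != v i) <= S%:R.
Proof.
rewrite -cardfs_gt0 => A_gt0 leS.
rewrite -mulr_suml ler_pdivrMr ?ltr0n // -natr_sum -natrM ler_nat.
under eq_bigr => i _ do rewrite card_fset_sum1 -big_fset_condE big_mkcond /=.
rewrite exchange_big /= card_fset_sum1 big_distrr /= !big_seq.
by apply: leq_sum => a aA; rewrite muln1 -[leqLHS]/(hamming (p a) v) leS.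
Qed.

(** Double counting of the sum of all displacement proportions: the edges of
    the cube bound it from below, the vertices from above. *)
Lemma cube_dim_le n (K : choiceType) (A : cube n -> {fset K})
    (p : K -> cube n) (S : nat) :
  (forall v, A v != fset0) ->
  (forall v i, A v `&` A (flip i v) != fset0) ->
  (forall v i, #|` A v `|` A (flip i v)| <= 2 * #|` A v `&` A (flip i v)|)%N ->
  (forall v a, a \in A v -> (hamming (p a) v <= S)%N) ->
  (n <= 4 * S)%N.
Proof.
move=> A_neq0 I_neq0 leUI leS.
pose P v i := proportion (A v) (fun a => p a i != v i).
have edge i v : 2^-1 <= P v i + P (flip i v) i.
  apply: half_le_proportions => // a.
  by rewrite ffunE eqxx addbT; case: (p a i) (v i) => [] [].
have coord i : \sum_(v : cube n) (2^-1 : rat) <= 2 * \sum_v P v i.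
  rewrite mulr_natl [leRHS]mulr2n.
  rewrite [X in _ <= _ + X](reindex_inj (inv_inj (flipK i))) -big_split /=.
  by apply: ler_sum => v _; apply: edge.
have vertex : \sum_v \sum_(i < n) P v i <= \sum_(v : cube n) (S%:R : rat).
  by apply: ler_sum => v _; apply: sum_proportion_le (leS v).
have lower : \sum_(i < n) \sum_(v : cube n) (2^-1 : rat)
    <= 2 * \sum_(i < n) \sum_v P v i.
  by rewrite mulr_sumr; apply: ler_sum => i _; apply: coord.
move: vertex lower; rewrite exchange_big /= !sumr_const card_ord => vertex lower.
have cube_gt0 : (0 < #|{: cube n}|)%N.
  by apply/card_gt0P; exists [ffun=> true].
have : (n * #|{: cube n}|)%:R <= (4 * S * #|{: cube n}|)%:R :> rat.
  rewrite -mulrnA mulnC -[leLHS]mulr_natl in lower.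
  rewrite -mulrnA in vertex.
  by rewrite -mulnA (natrM _ 4); lra.
by rewrite ler_nat leq_pmul2r.
Qed.

Theorem theorem2p6 (R : realType) (X : metricType R)
    (X_nonempty : ([set: X] !=set0)%classic) :
  (exists k : nat, (1 <= k)%N /\ has_prisms X k) -> ~ property_A X.
Proof.
move=> [k [k_ge1 prismX]] propA; have [x0 _] := X_nonempty.
have k_gt0 : (0 : R) < k%:R by rewrite ltr0n.
have [A [A_neq0 A_close [B [B_gt0 A_near]]]] := propA k%:R 1 k_gt0 ltr01.
(* If [a] in [A (phi v)] has first component [y], then [phi v] and [phi (p a)]
   are both within [B] of [y]; as [k >= 1], [v] and [p a] differ in at most
   [2 B] coordinates. *)
pose S := Num.bound (2 * B); pose n := (4 * S).+1.
have [phi phiE] := prisms_cube n x0 prismX.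
(* Any vertex within [B] will do; the default is only reached at points far
   from the whole cube, which belong to none of the sets [A (phi v)]. *)
pose p (a : X * nat) : cube n :=
  odflt [ffun=> true] [pick v | mdist (phi v) a.1 <= B].
have phi_flip v i : mdist (phi v) (phi (flip i v)) <= k%:R.
  by rewrite phiE hamming_flip mulr1.
suff : (n <= 4 * S)%N by rewrite ltnn.
apply: (@cube_dim_le n _ (fun v => A (phi v)) p) => // [v i|v i|v [y m] yA].
- by have [] := A_close _ _ (phi_flip v i).
- have [] := A_close _ _ (phi_flip v i); rewrite -cardfs_gt0 => I_gt0.
  rewrite ler_pdivrMr ?ltr0n // mul1r ler_nat /fset_symdiff.
  move=> D_le.
  have -> : A (phi v) `|` A (phi (flip i v)) =
    ((A (phi v) `\` A (phi (flip i v))) `|` (A (phi (flip i v)) `\` A (phi v)))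
      `|` (A (phi v) `&` A (phi (flip i v))).
    apply/fsetP => a; rewrite !inE.
    by case: (a \in A (phi v)); case: (a \in A (phi (flip i v))).
  rewrite (leq_trans (leq_trans (leq_addr _ _) (eq_leq (cardfsUI _ _)))) //.
  by rewrite mul2n -addnn leq_add2r.
- have near_v : mdist (phi v) y <= B := A_near _ _ _ yA.
  have near_p : mdist (phi (p (y, m))) y <= B.
    rewrite /p; case: pickP => [w //|/(_ v)] /=.
    by rewrite near_v.
  rewrite -(ler_nat R); apply: ltW.
  apply: le_lt_trans (archi_boundP _); last by rewrite mulr_ge0 ?ltW.
  apply: (@le_trans _ _ (mdist (phi (p (y, m))) (phi v))).
    by rewrite phiE ler_peMl ?ler0n // ler1n.
  rewrite (le_trans (metric_triangle _ y _)) // (metric_sym y).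
  by rewrite mulr_natl mulr2n lerD.
Qed.
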